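(* Let $q$ be an odd prime power and let $K=K(g)$ be integers with $\log g\cdot\log_q g\le K$ and $K=o(g)$ as $g\to\infty$. Then, for $D\in\mathbb{F}_q[x]$ monic square-free of degree $2g+1$, almost all zeros of $\mathcal{F}_K(u,\chi_D)$ are simple: the number of distinct zeros of $\mathcal{F}_K(u,\chi_D)$ is at least $2g(1+o(1))$ while the number of its multiple zeros is $o(g)$, as $g\to\infty$.
   Context: $\chi_D(f)=(D/f)$ is the quadratic character (Jacobi symbol) on $\mathbb{F}_q[x]$. $\Lambda(f)=\deg P$ if $f=P^n$ with $P$ monic irreducible, $n\ge1$, else $0$; $P_K(u,\chi_D)=\exp\big(\sum_{k=1}^{K}\sum_{f\ \mathrm{monic},\ \deg f=k}\Lambda(f)\chi_D(f)u^k/k\big)$; $\mathcal{F}_K(u,\chi_D)=\tfrac12(P_K(u,\chi_D)+(qu^2)^gP_K(\overline u,\chi_D))$, whose zeros all lie on $|u|=q^{-1/2}$. A zero $q^{-1/2}e(\theta)$ of $\mathcal{F}_K$ is simple if $\frac{d}{d\theta}\mathcal{F}_K(q^{-1/2}e(\theta),\chi_D)\ne0$ there. $e(x)=e^{2\pi ix}$. *)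

(* Defs.v *)
From HB Require Import structures.
From mathcomp Require Import all_boot all_order all_algebra.
From mathcomp Require Export qpoly.
From mathcomp Require Export complex.
From mathcomp Require Import all_classical all_reals all_analysis.

Set Implicit Arguments.
Unset Strict Implicit.
Unset Printing Implicit Defensive.

Import Order.TTheory GRing.Theory Num.Theory.
Import numFieldNormedType.Exports.

Local Open Scope classical_set_scope.
Local Open Scope ring_scope.
Local Open Scope complex_scope.

Section PolynomialArithmetic.
Variable F : finFieldType.
Implicit Types f P D : {poly F}.

Definition squarefree_poly D := forall P, (1 < size P)%N -> ~~ (P ^+ 2 %| D).

Definition monic_irr P := (P \is monic) && irreducibleb P.

Definition legendre D P : int :=
  if P %| D then 0
  else if `[< exists a : {poly F}, P %| a ^+ 2 - D >] then 1 else -1.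

(* The exact power of P in f, for f != 0 and P nonconstant: then P ^+ e %| f
   forces e <= deg f < size f. *)
Definition multiplicity P f : nat :=
  (\max_(e < size f | (P ^+ e %| f)%R) e)%N.

(* For f monic; every prime factor of f has size at most size f. *)
Definition jacobi D f : int :=
  \prod_(P : {poly_(size f) F} | monic_irr P) legendre D P ^+ multiplicity P f.

Definition mangoldt f : nat :=
  if [pick P : {poly_(size f) F} |
        monic_irr P && `[< exists2 n, (0 < n)%N & f = (P : {poly F}) ^+ n >]]
  is Some P then (size P).-1 else 0%N.

End PolynomialArithmetic.

Section TruncatedProduct.
Variable R : realType.
Implicit Types (z u : R[i]) (t : R).

Definition cexp z : R[i] :=
  (expR (complex.Re z))%:C * (cos (complex.Im z) +i* sin (complex.Im z)).

Definition e2pi t : R[i] := cexp ((2 * pi * t)%:C * 'i).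

(* Derivative of a complex-valued function of a real variable; R[i] is not a
   normed R-module in the library, and its norm topology is carried by R[i]^o. *)
Definition is_deriv_R (phi : R -> R[i]) t (l : R[i]) :=
  (((phi (t + h) - phi t) / h%:C : R[i]^o) @[h --> (0 : R)^'] --> (l : R[i]^o)).

Variable F : finFieldType.
Implicit Type D : {poly F}.

Definition PK (K : nat) D u : R[i] :=
  cexp (\sum_(1 <= k < K.+1)
          \sum_(f : {poly_k.+1 F} | ((f : {poly F}) \is monic)
                                    && (size f == k.+1))
            (mangoldt f)%:R * (jacobi D f)%:~R * u ^+ k / k%:R).

Definition FK (K g : nat) D u : R[i] :=
  2^-1 * (PK K D u + (#|F|%:R * u ^+ 2) ^+ g * PK K D u^*).

Definition circle_pt t : R[i] := ((Num.sqrt #|F|%:R)^-1)%:C * e2pi t.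

Definition zeros (K g : nat) D : set R[i] := [set u | FK K g D u = 0].

Definition simple_zeros (K g : nat) D : set R[i] :=
  [set u | zeros K g D u /\
     exists t l, [/\ u = circle_pt t,
                     is_deriv_R (FK K g D \o circle_pt) t l & l != 0]].

Definition multiple_zeros (K g : nat) D : set R[i] :=
  zeros K g D `\` simple_zeros K g D.

End TruncatedProduct.

Arguments zeros R {F} K g D.
Arguments simple_zeros R {F} K g D.
Arguments multiple_zeros R {F} K g D.

(* Main.v *)
(* On the circle [u = q^(-1/2) e(t)] one has
   [F_K(u) = e(g t) |P_K(u)| cos (phi t)] with [phi t = 2 pi g t - arg P_K(u)],
   and [arg P_K(u)] is a trigonometric polynomial of degree at most [K] without
   constant term. Zeros are thus the points where [phi] lies in
   [pi/2 + pi Z]; since [phi] grows by [2 pi g] over a period, the intermediate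
   value theorem gives [2 g] of them. Such a zero is multiple only if
   [phi' t = 0], and [phi'] is a trigonometric polynomial of degree at most [K]
   with constant term [2 pi g != 0], so it has at most [2 K = o(g)] zeros.
   Off the circle, [|P_K(u)| = |P_K(conj u)|] forces [|q u^2| = 1]. *)

Require Import Defs.
From mathcomp Require Import all_boot all_order all_algebra finmap.
From mathcomp Require Import all_classical all_reals all_analysis.
From mathcomp Require Import zify ring lra.
Import Order.TTheory GRing.Theory Num.Theory.
Import numFieldNormedType.Exports.
Local Open Scope classical_set_scope.
Local Open Scope ring_scope.
Local Open Scope complex_scope.

(** * The unit circle and the complex exponential *)

Section UnitCircle.
Variable R : realType.
Implicit Types (x y t : R) (w z : R[i]).

Definition cis x : R[i] := cos x +i* sin x.

Lemma cisD x y : cis (x + y) = cis x * cis y.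
Proof. by rewrite /cis cosD sinD; simpc; congr (_ +i* _); rewrite addrC. Qed.

Lemma cis0 : cis 0 = 1.
Proof. by rewrite /cis cos0 sin0. Qed.

Lemma cisMn x n : cis (x * n%:R) = cis x ^+ n.
Proof.
elim: n => [|n IHn]; first by rewrite mulr0 cis0 expr0.
by rewrite -natr1 mulrDr mulr1 cisD IHn exprSr.
Qed.

Lemma cisJ x : (cis x)^*%C = cis (- x).
Proof. by rewrite /cis cosN sinN. Qed.

Lemma cis_mulJ x : cis x * (cis x)^*%C = 1.
Proof. by rewrite cisJ -cisD subrr cis0. Qed.

Lemma cis_neq0 x : cis x != 0.
Proof.
apply/eqP => x0; have := cis_mulJ x; rewrite x0 mul0r => /eqP.
by rewrite eq_sym oner_eq0.
Qed.

Lemma cis2pi : cis (2 * pi) = 1.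
Proof. by rewrite /cis mulr_natl cos2pi sin2pi. Qed.

Lemma cisDJ x : cis x + (cis x)^*%C = (2 * cos x)%:C.
Proof. by rewrite addcJ rmorphM rmorph_nat. Qed.

Lemma sin_eq0_small x : `|x| < pi -> sin x = 0 -> x = 0.
Proof.
move=> xpi sx0; apply/eqP; apply/negPn/negP => x0.
have : 0 < sin `|x| by apply: sin_gt0_pi; rewrite normr_gt0 x0.
by case: (ger0P x) => _; rewrite ?sinN sx0 ?oppr0 ltxx.
Qed.

Lemma cis_inj x y : `|x - y| < 2 * pi -> cis x = cis y -> x = y.
Proof.
move=> xy cxy; have : cis (x - y) = 1.
  by rewrite cisD cxy -cisJ cis_mulJ.
move=> [c1 _]; apply/eqP; rewrite -subr_eq0; set d := x - y in xy c1 *.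
(* The half-angle formula turns [cos d = 1] into [sin (d / 2) = 0], and [|d / 2| < pi] leaves only
   [0]. *)
suff : d / 2 = 0 by move=> /eqP; rewrite mulf_eq0 invr_eq0 pnatr_eq0 orbF.
apply: sin_eq0_small; first by
  rewrite normrM (gtr0_norm (x := 2^-1)) ?invr_gt0// ltr_pdivrMr// mulrC.
have := cos_mulr2n (d / 2); rewrite -(mulr_natr (d / 2)) divfK ?pnatr_eq0// c1.
rewrite cos2sin2 => h; apply/eqP; rewrite -sqrf_eq0; apply/eqP; lra.
Qed.

(** The arc cosine of the real part has sine [|b|]; the sign of [b] selects this angle or its
    opposite. *)
Lemma unit_circle_cis w : `|w| = 1 -> exists2 x, `|x| <= pi & w = cis x.
Proof.
case: w => a b /(congr1 (fun z => z ^+ 2)); rewrite -add_Re2_Im2 expr1n /=.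
move=> /complexI ab1.
have a1 : -1 <= a <= 1.
  by apply/andP; split; have := sqr_ge0 b; nra.
have [/andP[t0 tpi] ct] := acos_def a1; have st := sin_acos a1.
have {}st : sin (acos a) = `|b| by rewrite st -ab1 addrAC subrr add0r sqrtr_sqr.
have [b0|b0] := ger0P b.
  by exists (acos a); [rewrite ger0_norm | rewrite /cis ct st ger0_norm].
exists (- acos a); first by rewrite normrN ger0_norm.
by rewrite /cis cosN sinN ct st ltr0_norm// opprK.
Qed.

Lemma e2piE t : e2pi t = cis (2 * pi * t).
Proof. by rewrite /e2pi /cexp; simpc; rewrite expR0; simpc. Qed.

Lemma cexpE z : cexp z = (expR (complex.Re z))%:C * cis (complex.Im z).
Proof. by []. Qed.

Lemma cexpJ z : cexp z^*%C = (cexp z)^*%C.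
Proof. by case: z => a b; rewrite !cexpE /= /cis cosN sinN; simpc. Qed.

Lemma cexp_neq0 z : cexp z != 0.
Proof.
by rewrite cexpE mulf_neq0 ?cis_neq0// fmorph_eq0 gt_eqF// expR_gt0.
Qed.

End UnitCircle.

Arguments cis {R} x.

(** * Finiteness of level sets and of zeros of a cosine *)

Section RealAnalysis.
Variable R : realType.
Implicit Types (f df : R -> R) (a b v x t : R).

(* By Rolle, a point of the level set is determined by the set of critical
   points on its left. *)
Lemma finite_level_set f df a b v :
  (forall x, is_derive x 1 f (df x)) ->
  finite_set [set x | a < x < b /\ df x = 0] ->
  finite_set [set x | x \in `[a, b] /\ f x = v].
Proof.
move=> fdf finC; set C := (X in finite_set X) in finC.
set A := (X in finite_set X).
pose below x := [fset c in fset_set C | c < x]%fset.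
have below_lt x y : A x -> A y -> x < y -> below x <> below y.
  move=> [xab fx] [yab fy] xy bxy.
  have dvb z : derivable f z 1 by exact: ex_derive.
  have [|||c cxy dc] := @Rolle R f x y xy.
  - by move=> *.
  - by apply: derivable_within_continuous => z _.
  - by rewrite fx fy.
  move: cxy xab yab; rewrite !in_itv /= => /andP[xc cy] /andP[ax xb] /andP[ay yb].
  have Cc : C c.
    split; first by apply/andP; split; lra.
    by rewrite -(@derive_val _ _ _ _ _ _ _ (fdf c)) (@derive_val _ _ _ _ _ _ _ dc).
  have : c \in below y by rewrite !inE /= in_fset_set// cy andbT; apply/mem_set.
  by rewrite -bxy !inE /= [c < x]lt_gtF// andbF.
have below_inj : {in A &, injective below}.
  move=> x y; rewrite !inE => Ax Ay bxy.
  case: (ltgtP x y) => // xy; first by have := below_lt _ _ Ax Ay xy bxy.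
  by have := below_lt _ _ Ay Ax xy (esym bxy).
apply: (card_le_finite _ (finite_fset (fpowerset (fset_set C)))).
move: (inj_card_eq below_inj); rewrite card_eq_sym => /card_eqPle[h _].
apply: card_le_trans h _; apply: subset_card_le => _ [x _ <-] /=.
by rewrite fpowersetE; apply/fsubsetP => c; rewrite !inE => /andP[].
Qed.

(** Cut the interval into blocks of length [pi] from [a]. Two zeros in one block satisfy
    [sin (x - y) = 0] with [|x - y| < pi], so they coincide; the block index is therefore injective,
    and it is bounded. *)
Lemma finite_zeros_cos a b : finite_set [set x : R | x \in `[a, b] /\ cos x = 0].
Proof.
set A := (X in finite_set X); pose n x := Num.truncn ((x - a) / pi).
have pi0 := pi_gt0 R.
have n_inj : {in A &, injective n}.
  move=> x y; rewrite !inE => -[]; rewrite in_itv /= => /andP[ax _] cx [].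
  rewrite in_itv /= => /andP[ay _] cy nxy.
  apply/eqP; rewrite -subr_eq0; apply/eqP.
  apply: sin_eq0_small; last by rewrite sinB cx cy; ring.
  have := @truncn_itv _ ((x - a) / pi); have := @truncn_itv _ ((y - a) / pi).
  rewrite -/(n x) -/(n y) nxy !divr_ge0 ?subr_ge0 ?(ltW pi0)//.
  move=> /(_ isT) + /(_ isT); rewrite -natr1 !ler_pdivlMr// !ltr_pdivrMr//.
  rewrite !mulrDl mul1r => /andP[y1 y2] /andP[x1 x2].
  by rewrite ltr_norml; apply/andP; split; lra.
apply: (card_le_finite _ (finite_II (Num.truncn ((b - a) / pi)).+1)).
move: (inj_card_eq n_inj); rewrite card_eq_sym => /card_eqPle[h _].
apply: card_le_trans h _; apply: subset_card_le => _ [x [+ _] <-] /=.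
rewrite in_itv /= => /andP[ax xb]; rewrite ltnS; apply: le_truncn.
by rewrite ler_pM2r ?invr_gt0// lerD2r.
Qed.

(** The values of [f] stay between its minimum and maximum, where cosine has finitely many zeros,
    and each of these levels is attained finitely often. *)
Lemma finite_zeros_cos_comp f df a b : a <= b ->
  (forall x, is_derive x 1 f (df x)) ->
  finite_set [set x | a < x < b /\ df x = 0] ->
  finite_set [set x | x \in `[a, b] /\ cos (f x) = 0].
Proof.
move=> ab fdf finC.
have cf : {within `[a, b], continuous f}.
  by apply: derivable_within_continuous => z _; exact: ex_derive.
have [c _ maxc] := EVT_max ab cf; have [d _ mind] := EVT_min ab cf.
apply: (@sub_finite_set _ _ (\bigcup_(v in [set v : R | v \in `[f d, f c] /\ cos v = 0])
  [set x | x \in `[a, b] /\ f x = v])).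
  move=> x [xab cfx]; exists (f x) => //; split => //.
  by rewrite in_itv /= mind ?maxc.
apply: bigcup_finite; first exact: finite_zeros_cos.
by move=> v _; exact: finite_level_set fdf finC.
Qed.

End RealAnalysis.

(** * Complex-valued functions of a real variable *)

Section ComplexDerivative.
Variable R : realType.
Implicit Types (f A B : R -> R) (t a b : R).

Lemma is_derive_cvg_quotient f t a : is_derive t 1 f a ->
  (f (t + h) - f t) / h @[h --> (0 : R)^'] --> a.
Proof.
move=> dfa; have df : derivable f t 1 by exact: ex_derive.
rewrite -(@derive_val _ _ _ _ _ _ _ dfa); apply: cvg_trans df.
apply: near_eq_cvg; near=> h.
by rewrite /= /GRing.scale /= mulr1 [h + t]addrC mulrC.
Unshelve. all: by end_near. Qed.

Lemma is_deriv_R_complex A B t a b : is_derive t 1 A a -> is_derive t 1 B b ->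
  is_deriv_R (fun s => A s +i* B s) t (a +i* b).
Proof.
move=> /is_derive_cvg_quotient Aa /is_derive_cvg_quotient Bb.
(* A positive element of [R[i]] is real, so half of [Re e] is allotted to each component. *)
apply/cvgrPdist_le => /= e; rewrite ltcE /= => /andP[/eqP e_im e_re].
have e2 : 0 < complex.Re e / 2 by rewrite divr_gt0.
move/cvgrPdist_le: Aa => /(_ _ e2) Aa; move/cvgrPdist_le: Bb => /(_ _ e2) Bb.
near=> h.
have h0 : h != 0 by near: h; exact: nbhs_dnbhs_neq.
have hA : `|a - (A (t + h) - A t) / h| <= complex.Re e / 2 by near: h.
have hB : `|b - (B (t + h) - B t) / h| <= complex.Re e / 2 by near: h.
have -> : a +i* b - ((A (t + h) +i* B (t + h)) - (A t +i* B t)) / h%:C =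
    (a - (A (t + h) - A t) / h)%:C + 'i%C * (b - (B (t + h) - B t) / h)%:C.
  rewrite -fmorphV; simpc; congr (_ +i* _); ring.
apply: le_trans (ler_normD _ _) _.
rewrite normrM.
have -> : `|'i%C : R[i]| = 1 by rewrite normc_def /= expr0n expr1n add0r sqrtr1.
have normR x : `|x%:C : R[i]| = `|x|%:C.
  by rewrite normc_def /= expr0n addr0 sqrtr_sqr.
rewrite mul1r !normR -rmorphD lecE /= e_im eqxx /=; lra.
Unshelve. all: by end_near. Qed.

End ComplexDerivative.

(** * The phase and the polynomial governing its critical points *)

Section TrigonometricPhase.
Variables (R : realType) (a : nat -> R) (K g : nat).
Implicit Types t : R.

(** With suitable coefficients, this and [trig_sin] are the logarithm of the modulus and the
    argument of [PK] on the circle. *)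
Definition trig_cos (c : nat -> R) t :=
  \sum_(1 <= k < K.+1) c k * cos (2 * pi * k%:R * t).

Definition trig_sin (c : nat -> R) t :=
  \sum_(1 <= k < K.+1) c k * sin (2 * pi * k%:R * t).

Definition phase t := 2 * pi * g%:R * t - trig_sin a t.

Definition dphase t :=
  2 * pi * (g%:R - trig_cos (fun k => k%:R * a k) t).

Lemma is_derive_scale_id (b : R) t : is_derive t 1 (fun s => b * s) b.
Proof.
have := @is_deriveZ R R^o R^o id b t 1 1 (is_derive_id _ _).
by rewrite /GRing.scale /= mulr1.
Qed.

Lemma is_derive_sum_nat (f : nat -> R -> R) (df : nat -> R) m n t :
  (forall k, is_derive t 1 (f k) (df k)) ->
  is_derive t 1 (fun s => \sum_(m <= k < n) f k s) (\sum_(m <= k < n) df k).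
Proof.
move=> fdf; elim: n => [|n IHn].
  rewrite big_geq//; under eq_fun do rewrite big_geq//.
  exact: is_derive_cst.
have [mn|nm] := leqP m n; last first.
  rewrite big_geq//; under eq_fun do rewrite big_geq//.
  exact: is_derive_cst.
rewrite big_nat_recr//=; under eq_fun do rewrite big_nat_recr//=.
exact: is_deriveD.
Qed.

Lemma is_derive_trig_sin c t :
  is_derive t 1 (trig_sin c)
    (\sum_(1 <= k < K.+1) c k * (cos (2 * pi * k%:R * t) * (2 * pi * k%:R))).
Proof.
apply: is_derive_sum_nat => k; apply: is_deriveZ.
exact: (is_derive1_comp (is_derive_sin _) (is_derive_scale_id _ t)).
Qed.

Lemma is_derive_trig_cos c t :
  is_derive t 1 (trig_cos c)
    (\sum_(1 <= k < K.+1) c k * (- sin (2 * pi * k%:R * t) * (2 * pi * k%:R))).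
Proof.
apply: is_derive_sum_nat => k; apply: is_deriveZ.
exact: (is_derive1_comp (is_derive_cos _) (is_derive_scale_id _ t)).
Qed.

Lemma is_derive_phase t : is_derive t 1 phase (dphase t).
Proof.
have := is_deriveB (is_derive_scale_id (2 * pi * g%:R) t) (is_derive_trig_sin a t).
move=> h; apply: is_derive_eq h _; rewrite /dphase mulrBr; congr (_ - _).
by rewrite mulr_sumr; apply: eq_bigr => k _; ring.
Qed.

Lemma phase0 : phase 0 = 0.
Proof.
rewrite /phase /trig_sin mulr0 big1 ?subr0// => k _.
by rewrite mulr0 sin0 mulr0.
Qed.

Lemma phase1 : phase 1 = 2 * pi * g%:R.
Proof.
rewrite /phase /trig_sin mulr1 big1 ?subr0// => k _.
have : cis (2 * pi * k%:R) = 1 :> R[i] by rewrite cisMn cis2pi expr1n.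
by move=> [_ s0]; rewrite mulr1 s0 mulr0.
Qed.

(* [2 cos (2 pi k t) = w ^ k + w ^ (- k)] for [w = e(t)]; multiplying by
   [w ^ K] clears the negative powers. *)
Definition critical_poly : {poly R[i]} :=
  (2 * g)%:R *: 'X^K
  - \sum_(1 <= k < K.+1) (k%:R * a k)%:C *: ('X^(K + k) + 'X^(K - k)).

Lemma critical_polyE t :
  pi%:C * critical_poly.[e2pi t] = e2pi t ^+ K * (dphase t)%:C.
Proof.
rewrite /critical_poly hornerD hornerN hornerZ hornerXn horner_sum /dphase.
set w := e2pi t.
have -> : \sum_(1 <= k < K.+1) ((k%:R * a k)%:C *: ('X^(K + k) + 'X^(K - k))).[w]
    = w ^+ K * (2 * trig_cos (fun k => k%:R * a k) t)%:C.
  rewrite rmorphM /trig_cos.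
  rewrite rmorph_sum /= mulrA mulr_sumr; apply: eq_big_nat => k /andP[_ kK].
  rewrite hornerZ hornerD !hornerXn exprD.
  have wk : w ^+ k = cis (2 * pi * k%:R * t).
    by rewrite /w e2piE -cisMn; congr cis; ring.
  (* Conjugation inverts [w ^+ k], as [w] has modulus one. *)
  have -> : w ^+ (K - k) = w ^+ K * (w ^+ k)^*%C.
    by rewrite -{2}(subnK (ltnSE kK)) exprD -mulrA wk cis_mulJ mulr1.
  rewrite -mulrDr wk cisDJ !rmorphM /= !rmorph_nat; ring.
rewrite !(rmorphM, rmorphB, rmorph_nat) /= natrM; ring.
Qed.

Lemma size_critical_poly : (size critical_poly <= (2 * K).+1)%N.
Proof.
have size_mono c n : (n <= 2 * K)%N -> (size (c *: 'X^n : {poly R[i]}) <= (2 * K).+1)%N.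
  by move=> nK; apply: leq_trans (size_scale_leq _ _) _; rewrite size_polyXn.
apply: leq_trans (size_polyD _ _) _; rewrite geq_max size_mono ?leq_pmull//= size_polyN.
apply: leq_trans (size_sum _ _ _) _; rewrite big_nat_cond.
apply/bigmax_leqP_seq => k _ /andP[/andP[_ kK] _]; rewrite ltnS in kK.
apply: leq_trans (size_scale_leq _ _) _; apply: leq_trans (size_polyD _ _) _.
by rewrite !size_polyXn geq_max !ltnS mul2n -addnn leq_add2l kK leq_subLR addnCA leq_addr.
Qed.

(** The coefficient of ['X^K] is [2 * g]: the sum starts at [k = 1], so [K + k] and [K - k] both
    differ from [K]. *)
Lemma critical_poly_neq0 : (0 < g)%N -> critical_poly != 0.
Proof.
move=> g0; apply/eqP => /(congr1 (fun p : {poly R[i]} => p`_K)).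
rewrite coef0 coefB coefZ coefXn eqxx mulr1 coef_sum big_nat_cond big1.
  by rewrite subr0 => /eqP; rewrite pnatr_eq0 muln_eq0 /= -leqn0 leqNgt g0.
move=> k /andP[/andP[k0 kK] _].
rewrite coefZ coefD !coefXn.
have -> : (K == K + k)%N = false by apply/negbTE; lia.
have -> : (K == K - k)%N = false by apply/negbTE; lia.
by rewrite addr0 mulr0.
Qed.

End TrigonometricPhase.

Lemma finite_roots (L : idomainType) (p : {poly L}) :
  p != 0 -> finite_set [set x | root p x].
Proof.
move=> p0; apply: contrapT => /(infinite_set_fset (size p)) [B Bp sB].
have /(max_poly_roots p0)/(_ (fset_uniq B)) : all (root p) B.
  by apply/allP => x /Bp.
by rewrite ltnNge sB.
Qed.

(** * Location of the zeros and a criterion for simplicity *)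

Section ZerosOfFK.
Variables (R : realType) (F : finFieldType) (K g : nat) (D : {poly F}).
Implicit Types (t : R) (u : R[i]).

(** These coefficients of the exponent of [PK] are taken in [R], so that [PK] commutes with
    conjugation. *)
Definition log_coef k : R :=
  \sum_(f : {poly_k.+1 F} | ((f : {poly F}) \is monic) && (size f == k.+1))
    (mangoldt f)%:R * (jacobi D f)%:~R / k%:R.

Lemma PK_log_coef u :
  PK K D u = cexp (\sum_(1 <= k < K.+1) (log_coef k)%:C * u ^+ k).
Proof.
congr cexp; apply: eq_bigr => k _.
rewrite rmorph_sum mulr_suml; apply: eq_bigr => f _.
by rewrite !(rmorphM, fmorphV, rmorph_nat, rmorph_int) /= mulrAC.
Qed.

Lemma PK_conj u : PK K D u^*%C = (PK K D u)^*%C.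
Proof.
rewrite !PK_log_coef -cexpJ rmorph_sum; congr cexp; apply: eq_bigr => k _.
by rewrite rmorphM rmorphXn /= oppr0.
Qed.

Let r : R := Num.sqrt #|F|%:R.

Let card_gt0 : 0 < #|F|%:R :> R.
Proof. by rewrite ltr0n; apply/card_gt0P; exists 0. Qed.

Let r_gt0 : 0 < r.
Proof. by rewrite sqrtr_gt0. Qed.

Let r_neq0 : r != 0.
Proof. by rewrite gt_eqF. Qed.

Let sqr_r : r ^+ 2 = #|F|%:R.
Proof. by rewrite sqr_sqrtr// ltW. Qed.

(** The radius of the circle is absorbed into the coefficients, making the exponent a function of
    the angle alone. *)
Let a k : R := log_coef k / r ^+ k.

Lemma circle_ptE t : circle_pt F t = (r^-1)%:C * cis (2 * pi * t).
Proof. by rewrite /circle_pt e2piE. Qed.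

Lemma circle_pt_inj s t : `|s - t| < 1 -> circle_pt F s = circle_pt F t -> s = t.
Proof.
move=> st1; rewrite !circle_ptE => /mulfI.
rewrite fmorph_eq0 invr_eq0 => /(_ r_neq0) /cis_inj h.
have pi0 := pi_gt0 R; apply: (@mulfI _ (2 * pi)); first by rewrite mulf_neq0 ?pnatr_eq0 ?gt_eqF.
by apply: h; rewrite -mulrBr normrM gtr0_norm ?mulr_gt0// gtr_pMr ?mulr_gt0.
Qed.

Lemma PK_circle t :
  PK K D (circle_pt F t) = (expR (trig_cos R K a t))%:C * cis (trig_sin R K a t).
Proof.
rewrite PK_log_coef.
suff -> : \sum_(1 <= k < K.+1) (log_coef k)%:C * circle_pt F t ^+ k =
   trig_cos R K a t +i* trig_sin R K a t by [].
rewrite [RHS]complexE /= /trig_cos /trig_sin !rmorph_sum mulr_sumr -big_split /=.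
apply: eq_bigr => k _; rewrite circle_ptE exprMn -cisMn -rmorphXn mulrA -rmorphM.
rewrite exprVn -/(a k) /cis [X in cos X](_ : _ = 2 * pi * k%:R * t); last by ring.
rewrite [X in sin X](_ : _ = 2 * pi * k%:R * t); last by ring.
by rewrite [X in _ * X = _]complexE /= !rmorphM /=; ring.
Qed.

(** On the circle [q u^2 = e(2t)]. Once [e(g t)] is factored out, the two halves of [FK] are complex
    conjugates, and their mean is a real part. *)
Lemma FK_circle t : FK K g D (circle_pt F t) =
  cis (2 * pi * g%:R * t) *
  (expR (trig_cos R K a t) * cos (phase R a K g t))%:C.
Proof.
rewrite /FK PK_conj PK_circle.
set E := expR _; set S := trig_sin R K a t; set x := 2 * pi * g%:R * t.
have -> : (#|F|%:R * circle_pt F t ^+ 2) ^+ g = cis x * cis x.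
  rewrite circle_ptE [(_ * cis _) ^+ 2]exprMn -rmorphXn exprVn sqr_r fmorphV rmorph_nat mulrA.
  rewrite mulfV ?mul1r; last by rewrite pnatr_eq0 -lt0n -(ltr0n R).
  by rewrite -exprM mulnC exprM -cisMn [_ ^+ 2]expr2; congr (cis _ * cis _); rewrite /x; ring.
have -> : cis S = cis x * (cis (phase R a K g t))^*%C.
  by rewrite cisJ -cisD /phase -/x -/S; congr cis; ring.
set C := cis (phase R a K g t).
have conjM (z w : R[i]) : (z * w)^*%C = z^*%C * w^*%C by exact: rmorphM.
rewrite !conjM conjcK conjc_real.
have -> : cis x * cis x * (E%:C * ((cis x)^*%C * C)) = cis x * E%:C * C * (cis x * (cis x)^*%C).
  by ring.
rewrite cis_mulJ mulr1.
have -> : E%:C * (cis x * C^*%C) + cis x * E%:C * C = cis x * E%:C * (C + C^*%C) by ring.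
rewrite cisDJ !rmorphM rmorph_nat /=; by field.
Qed.

(** [PK] is an exponential, hence nonzero, and has equal moduli at [u] and its conjugate; so
    [|q u^2| ^ g = 1], and [g > 0] gives [|q u^2| = 1]. *)
Lemma FK_zero_on_circle u : (0 < g)%N -> FK K g D u = 0 ->
  exists2 t : R, t \in `[- 2^-1, 2^-1] & u = circle_pt F t.
Proof.
move=> g0 /eqP; rewrite /FK mulf_eq0 invr_eq0 pnatr_eq0 /= PK_conj => /eqP FK0.
have P0 : PK K D u != 0 by rewrite PK_log_coef cexp_neq0.
set z := #|F|%:R * u ^+ 2 in FK0.
have nz : `|z| = 1.
  apply/eqP; rewrite -(@pexpr_eq1 _ _ g)//.
  have /(congr1 Num.norm) : z ^+ g * (PK K D u)^*%C = - PK K D u.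
    by apply/eqP; rewrite -addr_eq0 addrC FK0.
  rewrite normrM normrX normcJ normrN => /(canRL (mulfK _)).
  by rewrite normr_eq0 P0 mulfV ?normr_eq0// => ->.
have : `|r%:C * u| = 1.
  apply/eqP; rewrite -(@pexpr_eq1 _ _ 2)// -normrX exprMn -rmorphXn sqr_r rmorph_nat.
  by apply/eqP.
move=> /unit_circle_cis [x xpi ruE]; have pi0 := pi_gt0 R.
have uE : u = (r^-1)%:C * cis x by rewrite -ruE fmorphV mulKf// fmorph_eq0.
exists (x / (2 * pi)).
  rewrite in_itv /= -ler_norml normrM (gtr0_norm (x := (2 * pi)^-1)) ?invr_gt0 ?mulr_gt0//.
  rewrite ler_pdivrMr ?mulr_gt0// mulrA mulVf ?mul1r// pnatr_eq0.
by rewrite circle_ptE uE [_ * (x / _)]mulrC divfK// mulf_neq0 ?pnatr_eq0 ?gt_eqF.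
Qed.

Lemma zeros_circle t : zeros R K g D (circle_pt F t) <-> cos (phase R a K g t) = 0.
Proof.
rewrite /zeros /= FK_circle; split=> [/eqP|->]; last by rewrite mulr0 mulr0.
rewrite mulf_eq0 (negbTE (cis_neq0 _ _)) /= fmorph_eq0 mulf_eq0.
by rewrite gt_eqF ?expR_gt0//= => /eqP.
Qed.

(** At a zero the real factor [A] vanishes, so the product rule leaves only [cis (x t) * dA]. There
    the cosine of the phase is [0], hence its sine is not, and [dA] vanishes only with [dphase]. *)
Lemma simple_zeros_circle t : zeros R K g D (circle_pt F t) ->
  dphase R a K g t != 0 -> simple_zeros R K g D (circle_pt F t).
Proof.
move=> zt dt0; split=> //; have /zeros_circle ct := zt.
pose A s := expR (trig_cos R K a s) * cos (phase R a K g s).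
pose x (s : R) : R := 2 * pi * g%:R * s.
pose dA := - (expR (trig_cos R K a t) * (sin (phase R a K g t) * dphase R a K g t)).
have A0 : A t = 0 by rewrite /A ct mulr0.
have dAP : is_derive t 1 A dA.
  have d1 := is_derive1_comp (is_derive_expR _) (is_derive_trig_cos R K a t).
  have d2 := is_derive1_comp (is_derive_cos _) (is_derive_phase R a K g t).
  apply: is_derive_eq (is_deriveM d1 d2) _.
  by rewrite /= ct scale0r addr0 /dA /GRing.scale /=; ring.
have dc : is_derive t 1 (fun s => cos (x s) * A s) (cos (x t) * dA).
  have d1 := is_derive1_comp (is_derive_cos _) (is_derive_scale_id R (2 * pi * g%:R) t).
  apply: is_derive_eq (is_deriveM d1 dAP) _.
  by rewrite A0 scale0r addr0.
have ds : is_derive t 1 (fun s => sin (x s) * A s) (sin (x t) * dA).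
  have d1 := is_derive1_comp (is_derive_sin _) (is_derive_scale_id R (2 * pi * g%:R) t).
  apply: is_derive_eq (is_deriveM d1 dAP) _.
  by rewrite A0 scale0r addr0.
exists t, ((cos (x t) * dA) +i* (sin (x t) * dA)); split => //.
  have -> : FK K g D \o circle_pt F = fun s => (cos (x s) * A s) +i* (sin (x s) * A s).
    by apply/funext => s /=; rewrite FK_circle -/(A s) /cis -/(x s); simpc.
  exact: is_deriv_R_complex.
have dA0 : dA != 0.
  rewrite oppr_eq0; apply: mulf_neq0; first by rewrite gt_eqF ?expR_gt0.
  apply: mulf_neq0 => //.
  apply/eqP => s0; have := cos2Dsin2 (phase R a K g t).
  by rewrite ct s0 expr0n addr0 => /eqP; rewrite eq_sym oner_eq0.
have : cis (x t) * dA%:C != 0 by rewrite mulf_neq0 ?cis_neq0// fmorph_eq0.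
by rewrite /cis; simpc.
Qed.

Lemma critical_root t :
  dphase R a K g t = 0 -> root (critical_poly R a K g) (e2pi t).
Proof.
move=> dt0; have /eqP := critical_polyE R a K g t; rewrite dt0 mulr0 mulf_eq0.
by rewrite fmorph_eq0 gt_eqF ?pi_gt0.
Qed.


(** * Counting zeros and multiple zeros *)

Hypothesis g_gt0 : (0 < g)%N.

(** On an open window of length one [e2pi] is injective, so critical points embed into the roots of
    the nonzero [critical_poly]. *)
Lemma finite_critical :
  finite_set [set t : R | - 2^-1 < t < 2^-1 /\ dphase R a K g t = 0].
Proof.
set C := (X in finite_set X).
have inj : {in C &, injective (@e2pi R)}.
  move=> s t; rewrite !inE => -[/andP[s1 s2] _] [/andP[t1 t2] _] st.
  apply: circle_pt_inj; last by rewrite /circle_pt st.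
  by rewrite ltr_norml; apply/andP; split; lra.
have := finite_roots _ _ (critical_poly_neq0 R a K g g_gt0).
apply: card_le_finite.
move: (inj_card_eq inj); rewrite card_eq_sym => /card_eqPle[h _].
apply: card_le_trans h _; apply: subset_card_le => _ [t [_ dt] <-] /=.
exact: critical_root.
Qed.

Lemma finite_zeros : finite_set (zeros R K g D).
Proof.
have lt_half : - 2^-1 <= 2^-1 :> R by lra.
have := finite_zeros_cos_comp R _ _ _ _ lt_half (is_derive_phase R a K g) finite_critical.
move=> /(finite_image (circle_pt F)); apply: sub_finite_set => u zu.
have [t t12 uE] := FK_zero_on_circle u g_gt0 zu.
by exists t => //; split => //; apply/zeros_circle; rewrite -uE.
Qed.

Lemma card_zeros : (2 * g <= #|` fset_set (zeros R K g D)|)%N.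
Proof.
apply: leq_card_fset_set; first exact: finite_zeros.
have pi0 := pi_gt0 R.
(* The levels [pi / 2 + j pi] with [j < 2 g] lie strictly between [phase 0 = 0] and
   [phase 1 = 2 pi g]; other [j] get the dummy value [0]. *)
have /choice[T TP] : forall j : nat, exists t : R, (j < 2 * g)%N ->
    [/\ 0 <= t, t < 1 & phase R a K g t = pi / 2 + pi *+ j].
  move=> j; have [jg|] := ltnP j (2 * g); last by exists 0.
  have jg' : pi / 2 + pi *+ j < 2 * pi * g%:R :> R.
    have : pi * j.+1%:R <= pi * (2 * g)%:R :> R by rewrite ler_pM2l// ler_nat.
    by rewrite -natr1 natrM -(mulr_natr pi); lra.
  have j0 : 0 < pi / 2 + pi *+ j :> R by rewrite ltr_pwDl ?divr_gt0// mulrn_wge0// ltW.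
  have [] := @IVT R (phase R a K g) 0 1 (pi / 2 + pi *+ j) ler01.
  - apply: derivable_within_continuous => t _.
    by have := is_derive_phase R a K g t => dp; exact: ex_derive.
  - rewrite phase0 phase1 min_l ?max_r; try by apply: ltW; apply: lt_trans jg'.
    by rewrite !ltW.
  move=> t; rewrite in_itv /= => /andP[t0 t1] pt; exists t => _; split => //.
  (* Excluding [t = 1] keeps all parameters within distance less than one, so distinct ones give
     distinct points of the circle. *)
  rewrite lt_neqAle t1 andbT; apply/eqP => t1'.
  by move: pt; rewrite t1' phase1 => pt; rewrite pt ltxx in jg'.
have T_inj : {in `I_(2 * g) &, injective (circle_pt F \o T)}.
  move=> i j; rewrite !inE /= => /TP[i0 i1 pi_] /TP[j0 j1 pj] /circle_pt_inj ij.
  have : T i = T j by apply: ij; rewrite ltr_norml; apply/andP; split; lra.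
  move=> /(congr1 (phase R a K g)); rewrite pi_ pj => /addrI /eqP.
  by rewrite -!(mulr_natr pi) (inj_eq (mulfI (lt0r_neq0 pi0))) eqr_nat => /eqP.
move: (inj_card_eq T_inj); rewrite card_eq_sym => /card_eqPle[h _].
apply: card_le_trans h _; apply: subset_card_le => _ [j /TP[_ _ pj] <-].
by apply/zeros_circle; rewrite pj (alternatingn (cosDpi (R := R))) cos_pihalf mulr0.
Qed.

(** Scaling by [r] moves the multiple zeros to distinct points of the unit circle, all roots of
    [critical_poly], whose number is less than its size, at most [2 * K + 1]. *)
Lemma card_multiple_zeros :
  (#|` fset_set (multiple_zeros R K g D)| <= 2 * K)%N.
Proof.
have fin : finite_set (multiple_zeros R K g D).
  by apply: sub_finite_set finite_zeros => u [].
rewrite -ltnS; apply: leq_trans (size_critical_poly R a K g).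
set A := fset_set _.
rewrite -[#|` A|](size_map ( *%R r%:C)) -[[seq _ | _ <- _]]/[seq r%:C * u | u <- A].
apply: max_poly_roots; first exact: critical_poly_neq0; last first.
  by rewrite map_inj_uniq ?fset_uniq//; apply: mulfI; rewrite fmorph_eq0.
apply/allP => _ /mapP[u /= + ->]; rewrite in_fset_set// inE => -[zu].
have [t _ uE] := FK_zero_on_circle u g_gt0 zu; rewrite uE in zu *.
move=> nsimple; rewrite /circle_pt mulrA -rmorphM mulfV// mul1r.
apply: critical_root; apply/eqP; apply/negPn/negP => dt0.
by apply: nsimple; exact: simple_zeros_circle.
Qed.

End ZerosOfFK.

(** * From bounds at fixed genus to the asymptotic statement *)

Theorem theorem17 (R : realType) (F : finFieldType) (K : nat -> nat)
    (oddq : odd #|F|)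
    (K_ge : \forall g \near \oo,
       ln (g%:R : R) * (ln (g%:R : R) / ln (#|F|%:R : R)) <= (K g)%:R)
    (K_o : (K g)%:R / g%:R @[g --> \oo] --> (0 : R)) :
  exists delta eta : nat -> R,
    [/\ delta @ \oo --> (0 : R),
        eta @ \oo --> (0 : R) &
        \forall g \near \oo, forall D : {poly F},
          D \is monic -> squarefree_poly D -> size D = ((2 * g + 1).+1)%N ->
          [/\ finite_set (zeros R (K g) g D),
              (2 * g%:R * (1 + delta g)
                 <= #|` fset_set (zeros R (K g) g D)|%:R)%R &
              (#|` fset_set (multiple_zeros R (K g) g D)|%:R
                 <= eta g * g%:R)%R]].
Proof.
(* The lower bound [2 g] is exact, so [delta] is zero; the bound [2 K] on multiple zeros dictates
   [eta], which tends to [0] by [K_o]. *)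
exists (fun=> 0), (fun g => 2 * ((K g)%:R / g%:R)); split; first exact: cvg_cst.
  by rewrite -(mulr0 2); exact: cvgMl_tmp.
near=> g => D _ _ _.
have g0 : (0 < g)%N by near: g; exact: nbhs_infty_gt.
split; first exact: finite_zeros.
  by rewrite addr0 mulr1 -natrM ler_nat; exact: card_zeros.
rewrite -mulrA divfK ?pnatr_eq0 -?lt0n// -natrM ler_nat.
exact: card_multiple_zeros.
Unshelve. all: by end_near. Qed.
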